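(* For every odd positive integer $m$, $\mathsf{s}_{2m}(\mathbb{Z}_2^{2m+1}) = 4m+5$.
   Context: For a positive integer $m$ and a nonnegative integer $d$, $\mathsf{s}_{2m}(\mathbb{Z}_2^d)$ denotes the smallest integer $s$ such that every sequence (repetitions allowed) of length $s$ of elements of the group $\mathbb{Z}_2^d$ has a subsequence of length $2m$ whose elements sum to $0$. *)

(* Defs.v *)
From mathcomp Require Import all_boot all_order all_algebra.

Set Implicit Arguments.
Unset Strict Implicit.
Unset Printing Implicit Defensive.

Import GRing.Theory.
Local Open Scope ring_scope.

Definition has_zero_sum_subseq (V : zmodType) (k : nat) (s : seq V) : Prop :=
  exists t : seq V, [/\ subseq t s, size t = k & \sum_(x <- t) x = 0].

Definition forces_zero_sum (V : zmodType) (k l : nat) : Prop :=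
  forall s : seq V, size s = l -> has_zero_sum_subseq k s.

(* "s_k(V) = l".  A relation rather than a function of V and k, because for
   some V and k (such as k odd and V = Z_2^d with d > 0) no length forces a
   zero-sum subsequence of length k. *)
Definition zero_sum_constant_is (V : zmodType) (k l : nat) : Prop :=
  forces_zero_sum V k l /\
  forall l' : nat, forces_zero_sum V k l' -> (l <= l')%N.

Definition Z2pow (d : nat) : zmodType := 'rV['F_2]_d.

(* Main.v *)
(* Upper bound.  Translating the sequence does not change sums of even length.
   A maximal family of disjoint pairs {a_i, b_i} of terms whose gaps a_i + b_i
   are independent has gaps spanning the direction space U of the affine hull,
   as long as three terms are left over.  If there are at most 2m pairs, take
   2m terms containing exactly one term of each pair: their sum lies in U, and
   switching between a_i and b_i makes it 0.  Otherwise there are 2m + 1 pairs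
   and three remaining terms; let phi_k be the dual basis of the gaps, translate
   so that one remaining term is 0, and put A_ki = phi_k(a_i).  Consider sets
   that contain all or nothing of the pairs indexed by a set T, some remaining
   terms, and one freely chosen term of every other pair: such a choice of size
   2m yields a zero sum as soon as phi_k vanishes for k in T.  If there is no
   zero sum, then T = {k} shows that the row sums of A off the diagonal are 1,
   and sets T of size 2 and 3 show that i -> j iff A_ij = 1 is an oriented graph
   that is transitive.  Some vertex then has no out-neighbour, so that its row
   sum is 0, a contradiction.

   Lower bound.  Take 4m + 4 points whose even zero-sum sets form the doubly
   even code d_(4m+4)^+: these sets are the unions of an even number of pairs,
   together with certain sets of size 2m + 2, and none of them has size 2m, since
   2m = 2 mod 4. *)
Require Import Defs.
From mathcomp Require Import all_boot all_order all_algebra zify.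

Set Implicit Arguments.
Unset Strict Implicit.
Unset Printing Implicit Defensive.

Import GRing.Theory.
Local Open Scope ring_scope.

(** * Zero sums in coordinates, for terms arranged in pairs *)

Lemma F2_cases (x : 'F_2) : x = 0 \/ x = 1.
Proof. by case: x => [[|[|n]] lt_n] //; [left | right]; apply: val_inj. Qed.

Lemma F2_addxx (x : 'F_2) : x + x = 0.
Proof. by case: (F2_cases x) => ->; apply: val_inj. Qed.

(** The indices [inl (k, false)] and [inl (k, true)] stand for the two terms [a_k] and [b_k] of a
    pair, and [inr q] for a term outside all pairs. *)
Definition selection (K L : finType) (P I : {set K}) (eps : K -> bool)
    (Q : {set L}) : {set (K * bool) + L} :=
  [set j | match j with
           | inl (k, e) => (k \in P) || (k \in I) && (e == eps k)
           | inr q => q \in Q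
           end].

Lemma sum_selection (M : nmodType) (K L : finType) (P I : {set K})
    (eps : K -> bool) (Q : {set L}) (F : (K * bool) + L -> M) :
    [disjoint P & I] ->
  \sum_(j in selection P I eps Q) F j =
    \sum_(k in P) (F (inl (k, false)) + F (inl (k, true)))
    + \sum_(k in I) F (inl (k, eps k)) + \sum_(q in Q) F (inr q).
Proof.
move=> dPI; rewrite big_sumType /=; congr (_ + _); last first.
  by apply: eq_bigl => q; rewrite inE.
rewrite big_mkcond /=.
transitivity (\sum_k \sum_e (if inl (k, e) \in selection P I eps Q
                             then F (inl (k, e)) else 0)).
  by rewrite pair_bigA; apply: eq_bigr => -[].
rewrite [X in _ = X + _]big_mkcond [X in _ = _ + X]big_mkcond -big_split /=.
apply: eq_bigr => k _; rewrite big_bool /= !inE.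
case kP: (k \in P); first by rewrite (disjointFr dPI kP) /= addr0 addrC.
by case: (k \in I) => /=; rewrite ?addr0 ?add0r //; case: (eps k);
  rewrite /= ?addr0 ?add0r.
Qed.

(** Here [phi k j] is coordinate [k] of term [j]. With [2m + 1] pairs the condition on [#|A|] reads
    [#|A| = 2m]. *)
Definition coordinate_zero_sum (K J : finType) (phi : K -> J -> 'F_2) : bool :=
  [exists A : {set J},
     (#|A|.+1 == #|K|) && [forall k, \sum_(j in A) phi k j == 0]].

(* [T] indexes the pairs that are not used exactly once; [P] those used fully.
   For [k] outside [T] the coordinate [k] is corrected by the choice between
   the two terms of the pair [k], which moves no other coordinate. *)
Lemma selection_zero_sum (K L : finType) (phi : K -> (K * bool) + L -> 'F_2)
    (T P : {set K}) (Q : {set L}) :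
    (forall k i, phi k (inl (i, true)) = phi k (inl (i, false)) + (k == i)%:R) ->
    P \subset T -> #|T| = (2 * #|P| + #|Q|).+1 ->
    (forall k, k \in T ->
       (k \in P)%:R + \sum_(i in ~: T) phi k (inl (i, false))
       + \sum_(q in Q) phi k (inr q) = 0) ->
  coordinate_zero_sum phi.
Proof.
move=> diff PT cT zT.
pose S k := (k \in P)%:R + \sum_(i in ~: T) phi k (inl (i, false))
              + \sum_(q in Q) phi k (inr q).
have dPT : [disjoint P & ~: T] by rewrite disjoints_subset setCK.
apply/existsP; exists (selection P (~: T) (fun k => S k != 0) Q); apply/andP; split.
  rewrite -sum1_card sum_selection // !sum_nat_const !muln1.
  by apply/eqP; rewrite -(cardsC T) cT; lia.
apply/forallP => k; apply/eqP; rewrite sum_selection //.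
have -> : \sum_(i in P) (phi k (inl (i, false)) + phi k (inl (i, true)))
            = (k \in P)%:R :> 'F_2.
  under eq_bigr do rewrite diff addrA F2_addxx add0r.
  case kP: (k \in P).
    rewrite (bigD1 k) //= eqxx big1 ?addr0 // => i /andP[_ /negbTE].
    by rewrite eq_sym => ->.
  by rewrite big1 // => i iP; case: eqP => // ki; rewrite ki iP in kP.
have -> : \sum_(i in ~: T) phi k (inl (i, S i != 0))
   = \sum_(i in ~: T) phi k (inl (i, false)) + ((k \notin T) && (S k != 0))%:R.
  have -> : ((k \notin T) && (S k != 0))%:R =
      \sum_(i in ~: T) ((k == i) && (S i != 0))%:R :> 'F_2.
    case kT: (k \in T) => /=.
      rewrite big1 // => i; rewrite inE; case: eqP => //= <-.
      by rewrite kT.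
    rewrite (bigD1 k) ?inE ?kT //= eqxx big1 ?addr0 // => i /andP[_ /negbTE].
    by rewrite eq_sym => ->.
  rewrite -big_split /=; apply: eq_bigr => i _.
  by case: (S i != 0); rewrite ?andbT ?andbF ?addr0.
rewrite addrA (addrAC _ _%:R) -/(S k).
case kT: (k \in T) => /=; first by rewrite addr0; exact: zT.
by case: (F2_cases (S k)) => ->; apply: val_inj.
Qed.

(** * The oriented graph of a configuration without zero sum *)

(** A vertex [x] of minimal out-degree works: by transitivity the out-neighbours of an out-neighbour
    [y] are among those of [x], and [y] itself is missing. *)
Lemma acyclic_outdegree (K : finType) (e : rel K) (x0 : K) :
  irreflexive e -> transitive e -> exists x, forall y, ~~ e x y.
Proof.
move=> irr tr; pose d x := #|[set y | e x y]|.
case: (arg_minnP (P := xpredT) d (i0 := x0)) => // x _ min_x.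
exists x => y; apply/negP => exy.
have /proper_card : [set z | e y z] \proper [set z | e x z].
  apply/properP; split; first by apply/subsetP => z; rewrite !inE; apply: tr.
  by exists y; rewrite !inE ?irr.
by rewrite ltnNge min_x.
Qed.

Lemma normalized_zero_sum (K : finType)
    (phi : K -> (K * bool) + 'I_3 -> 'F_2) (k0 : K) :
    (forall k i, phi k (inl (i, true)) = phi k (inl (i, false)) + (k == i)%:R) ->
    (forall k, phi k (inr ord0) = 0) ->
  coordinate_zero_sum phi.
Proof.
move=> diff norm; apply: contraT => nzs; exfalso.
pose A k i := phi k (inl (i, false)).
have nz (T P : {set K}) (Q : {set 'I_3}) :
    P \subset T -> #|T| = (2 * #|P| + #|Q|).+1 ->
    ~ (forall k, k \in T -> (k \in P)%:R + \sum_(i in ~: T) A k i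
                           + \sum_(q in Q) phi k (inr q) = 0).
  by move=> PT cT zT; rewrite (selection_zero_sum diff PT cT zT) in nzs.
have row k : \sum_(i in ~: [set k]) A k i = 1.
  case: (F2_cases (\sum_(i in ~: [set k]) A k i)) => // rk0.
  case: (nz [set k] set0 set0); rewrite ?sub0set ?cards1 ?cards0 //.
  by move=> i /set1P ->; rewrite inE big_set0 addr0 add0r.
have rowC k (B : {set K}) : k \notin B ->
    \sum_(i in ~: (k |: B)) A k i = 1 + \sum_(i in B) A k i.
  move=> kB; rewrite -(row k) [in RHS](big_setID B) /=.
  have -> : ~: [set k] :&: B = B.
    by apply/setIidPr; rewrite subsetC sub1set inE.
  rewrite addrAC F2_addxx add0r; apply: eq_bigl => i.
  by rewrite !inE negb_or andbC.
(* For [#|T| = 2] the size condition forces [P] empty and a single remaining term. *)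
have nz2 i j q : i != j ->
    1 + A i j + phi i (inr q) = 0 -> 1 + A j i + phi j (inr q) = 0 -> False.
  move=> ij zi zj; case: (nz [set i; j] set0 [set q]).
  - exact: sub0set.
  - by rewrite cards0 cards1 cards2 ij.
  move=> k /set2P[] ->; rewrite inE add0r big_set1.
    by rewrite rowC ?big_set1 // inE.
  by rewrite setUC rowC ?big_set1 // inE eq_sym.
(* For [#|T| = 3] it allows one full pair or two remaining terms; the first serves transitivity, the
   second excludes 3-cycles. *)
have nz3 x y z (P : {set K}) (Q : {set 'I_3}) : x != y -> y != z -> z != x ->
    P \subset [set x; y; z] -> (2 * #|P| + #|Q| = 2)%N ->
    (x \in P)%:R + (1 + (A x y + A x z)) + \sum_(q in Q) phi x (inr q) = 0 ->
    (y \in P)%:R + (1 + (A y z + A y x)) + \sum_(q in Q) phi y (inr q) = 0 ->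
    (z \in P)%:R + (1 + (A z x + A z y)) + \sum_(q in Q) phi z (inr q) = 0 ->
    False.
  move=> xy yz zx PT cPQ zX zY zZ; have yx := xy; have zy := yz; have xz := zx.
  rewrite eq_sym in yx; rewrite eq_sym in zy; rewrite eq_sym in xz.
  case: (nz [set x; y; z] P Q) => //.
    by rewrite cPQ -setUA cardsU1 cards2 !inE negb_or xy xz yz.
  have rowC3 u v w : u != v -> v != w -> w != u ->
      \sum_(i in ~: (u |: [set v; w])) A u i = 1 + (A u v + A u w).
    move=> uv vw wu; rewrite rowC; last by rewrite !inE negb_or uv eq_sym wu.
    by rewrite big_setU1 ?big_set1 // inE.
  move=> k; rewrite !inE -orbA => /or3P[] /eqP ->.
  - by rewrite -setUA rowC3.
  - have -> : [set x; y; z] = y |: [set z; x]; last by rewrite rowC3.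
    by apply/setP => w; rewrite !inE -orbA orbC -orbA.
  have -> : [set x; y; z] = z |: [set x; y]; last by rewrite rowC3.
  by rewrite setUC.
have orient i j : i != j -> A i j = 1 -> A j i = 0.
  move=> ij Aij; case: (F2_cases (A j i)) => // Aji.
  by case: (nz2 i j ord0); rewrite // ?Aij ?Aji norm; apply: val_inj.
(* Since [A j i = 0] by [orient], the value [phi i (inr q) = 0] would satisfy both equations of
   [nz2]. *)
have mono i j q : i != j -> A i j = 1 -> phi j (inr q) = 1 -> phi i (inr q) = 1.
  move=> ij Aij pj; case: (F2_cases (phi i (inr q))) => // pi0.
  by case: (nz2 i j q); rewrite // ?Aij ?(orient _ _ ij Aij) ?pj ?pi0;
    apply: val_inj.
(* [mono] makes [phi _ (inr q)] constant on a cycle, and two of the three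
   remaining terms [inr q] agree there. *)
have acyclic x y z : x != y -> y != z -> z != x ->
    A x y = 1 -> A y z = 1 -> A z x = 1 -> False.
  move=> xy yz zx Axy Ayz Azx.
  have cyc q : phi x (inr q) = phi y (inr q) /\ phi x (inr q) = phi z (inr q).
    case: (F2_cases (phi x (inr q))) => px; last first.
      by have pz := mono _ _ q zx Azx px; rewrite px pz (mono _ _ q yz Ayz pz).
    case: (F2_cases (phi y (inr q))) => py; last by rewrite (mono _ _ q xy) in px.
    case: (F2_cases (phi z (inr q))) => pz; last by rewrite (mono _ _ q yz) in py.
    by rewrite px py pz.
  have [q [q' [qq' pqq']]] : exists q, exists q', q != q' /\
      phi x (inr q) + phi x (inr q') = 0.
    pose q1 : 'I_3 := inord 1; pose q2 : 'I_3 := inord 2.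
    case: (F2_cases (phi x (inr q1))) => p1.
      exists ord0, q1; rewrite norm p1 addr0; split=> //.
      by rewrite -val_eqE /= inordK.
    case: (F2_cases (phi x (inr q2))) => p2.
      exists ord0, q2; rewrite norm p2 addr0; split=> //.
      by rewrite -val_eqE /= inordK.
    exists q1, q2; rewrite p1 p2 F2_addxx; split=> //.
    by rewrite -val_eqE /= !inordK.
  have [sx [cx cx']] := (pqq', (cyc q, cyc q')).
  apply: (nz3 x y z set0 [set q; q']) => //; first exact: sub0set.
  - by rewrite cards0 cards2 qq'.
  - rewrite big_setU1 ?big_set1 ?inE //= sx Axy (orient _ _ zx Azx).
    exact: val_inj.
  - rewrite big_setU1 ?big_set1 ?inE //= -(proj1 cx) -(proj1 cx') sx Ayz.
    by rewrite (orient _ _ xy Axy); apply: val_inj.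
  rewrite big_setU1 ?big_set1 ?inE //= -(proj2 cx) -(proj2 cx') sx Azx.
  by rewrite (orient _ _ yz Ayz); apply: val_inj.
pose e i j := (i != j) && (A i j == 1).
have [|y x z|x no_out] := @acyclic_outdegree K e k0.
- by move=> x; rewrite /e eqxx.
- case/andP=> xy /eqP Axy /andP[yz /eqP Ayz].
  have zx : z != x.
    apply/eqP => zx; have := orient _ _ xy Axy; rewrite -zx Ayz.
    by move/eqP; rewrite oner_eq0.
  rewrite /e eq_sym zx /=.
  case: (F2_cases (A x z)) => Axz; last by rewrite Axz.
  case: (F2_cases (A z x)) => Azx; last by case: (acyclic x y z).
  (* Now [A x z] and [A z x] both vanish. Only coordinate [z] is still nonzero, and taking the pair
     [z] in full corrects it. *)
  case: (nz3 x y z [set z] set0) => //.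
  - by rewrite sub1set !inE eqxx !orbT.
  - by rewrite cards1 cards0.
  - rewrite inE eq_sym (negbTE zx) big_set0 Axy Axz; exact: val_inj.
  - rewrite inE (negbTE yz) big_set0 Ayz (orient _ _ xy Axy); exact: val_inj.
  rewrite inE eqxx big_set0 Azx (orient _ _ yz Ayz); exact: val_inj.
have := row x; rewrite big1 => [/eqP|i].
  by rewrite eq_sym oner_eq0.
rewrite !inE => ix; case: (F2_cases (A x i)) => // Axi.
by have := no_out i; rewrite /e eq_sym ix Axi eqxx.
Qed.

(** As [#|A| = #|K| - 1] is even, adding the term [inr ord0] to every term leaves the sum over [A]
    unchanged. *)
Lemma coordinate_zero_sum_odd (K : finType)
    (phi : K -> (K * bool) + 'I_3 -> 'F_2) :
    odd #|K| ->
    (forall k i, phi k (inl (i, true)) = phi k (inl (i, false)) + (k == i)%:R) ->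
  coordinate_zero_sum phi.
Proof.
move=> oddK diff; have /card_gt0P[k0 _] := odd_gt0 oddK.
have diff0 k i : phi k (inl (i, true)) + phi k (inr ord0) =
    phi k (inl (i, false)) + phi k (inr ord0) + (k == i)%:R.
  by rewrite diff addrAC.
have /existsP[A /andP[/eqP cA /forallP zA]] :=
  @normalized_zero_sum K (fun k j => phi k j + phi k (inr ord0)) k0 diff0
    (fun k => F2_addxx _).
apply/existsP; exists A; rewrite cA eqxx; apply/forallP => k.
have := zA k; rewrite big_split /= sumr_const.
have -> : #|A| = (#|A|./2 * 2)%N by move: oddK; rewrite -cA /=; lia.
by rewrite mulrnA mulr2n F2_addxx addr0.
Qed.

(** * Disjoint pairs with independent gaps *)

Lemma F2_vect_addxx (V : vectType 'F_2) (v : V) : v + v = 0.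
Proof.
rewrite -mulr2n -scaler_nat; have -> : 2%:R = 0 :> 'F_2 by apply: val_inj.
by rewrite scale0r.
Qed.

Lemma F2_vect_telescope (V : vectType 'F_2) (u v w : V) : (u + v) + (v + w) = u + w.
Proof. by rewrite addrA -(addrA u) F2_vect_addxx addr0. Qed.

Lemma memv_span_cons (V : vectType 'F_2) (u v : V) (X : seq V) :
  (v \in <<u :: X>>%VS) = (v \in <<X>>%VS) || (v + u \in <<X>>%VS).
Proof.
rewrite span_cons; apply/memv_addP/orP.
  case=> _ /vlineP[c ->] [x Xx ->]; case: (F2_cases c) => ->.
    by left; rewrite scale0r add0r.
  by right; rewrite scale1r addrAC F2_vect_addxx add0r.
case=> Xv; first by exists 0; rewrite ?mem0v //; exists v; rewrite ?add0r.
exists u; first exact: memv_line.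
by exists (v + u); rewrite // addrCA F2_vect_addxx addr0.
Qed.

Definition gaps (V : vectType 'F_2) (J : finType) (f : J -> V)
  (ps : seq (J * J)) : seq V := [seq f q.1 + f q.2 | q <- ps].

Definition endpoints (J : finType) (ps : seq (J * J)) : seq J :=
  flatten [seq [:: q.1; q.2] | q <- ps].

(** Disjointness concerns indices, so equal values of [f] may occur in different pairs. *)
Definition free_pairing (V : vectType 'F_2) (J : finType) (f : J -> V)
  (ps : seq (J * J)) : bool := uniq (endpoints ps) && free (gaps f ps).

Lemma size_endpoints (J : finType) (ps : seq (J * J)) :
  size (endpoints ps) = (2 * size ps)%N.
Proof. by elim: ps => // q ps IH; rewrite /= IH; lia. Qed.

Lemma endpointsP (J : finType) (ps : seq (J * J)) (j : J) :
  reflect (exists2 q, q \in ps & j = q.1 \/ j = q.2) (j \in endpoints ps).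
Proof.
apply: (iffP flatten_mapP) => -[q psq jq]; exists q => //.
  by move: jq; rewrite !inE => /orP[] /eqP; [left | right].
by rewrite !inE; case: jq => ->; rewrite eqxx ?orbT.
Qed.

Lemma nth_endpoints (J : finType) (ps : seq (J * J)) (j0 : J) (k : nat)
    (e : bool) : (k < size ps)%N ->
  nth j0 (endpoints ps) (2 * k + e) =
    (if e then (nth (j0, j0) ps k).2 else (nth (j0, j0) ps k).1).
Proof.
elim: ps k => // q ps IH [|k]; first by case: e {IH}.
move=> ltk; rewrite mulnS -addnA add2n.
exact: IH.
Qed.

Lemma rem_free_pairing (V : vectType 'F_2) (J : finType) (f : J -> V)
    (ps : seq (J * J)) (q : J * J) : q \in ps ->
  [/\ free_pairing f (q :: rem q ps) = free_pairing f ps,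
      endpoints (q :: rem q ps) =i endpoints ps
    & <<gaps f (q :: rem q ps)>>%VS = <<gaps f ps>>%VS].
Proof.
move=> /perm_to_rem pq; have pg := perm_map (fun q => f q.1 + f q.2) pq.
have pe : perm_eq (endpoints ps) (endpoints (q :: rem q ps)).
  by apply: perm_flatten; apply: perm_map.
split; first by rewrite /free_pairing (perm_uniq pe) (perm_free pg).
  by move=> j; rewrite (perm_mem pe).
by apply: eq_span => v; rewrite (perm_mem pg).
Qed.

Lemma three_outside (J : finType) (s : seq J) : (size s + 3 <= #|J|)%N ->
  exists r : 'I_3 -> J, injective r /\ forall i, r i \notin s.
Proof.
move=> szs; pose t := enum (~: [set j in s]).
have szt : (3 <= size t)%N.
  have le_s : (#|[set j in s]| <= size s)%N by rewrite cardsE card_size.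
  by rewrite -cardE; move: szs; rewrite -(cardsC [set j in s]); lia.
have /card_gt0P[j0 _] : (0 < #|J|)%N by apply: leq_trans szs; rewrite addnS.
exists (fun i => nth j0 t i); split=> [i j|i].
  have [lti ltj] := (leq_trans (ltn_ord i) szt, leq_trans (ltn_ord j) szt).
  move/eqP; rewrite nth_uniq ?enum_uniq // => /eqP; exact: val_inj.
have := mem_nth j0 (leq_trans (ltn_ord i) szt).
by rewrite mem_enum !inE.
Qed.

(* If an endpoint [a] of a pair [(a, b)] lies outside the coset that contains
   the three free points, then [(a, b)] is replaced by [(a, r)] and [(b, s)],
   where [r] and [s] are two free points that agree modulo the span of the
   other gaps. *)
Lemma extend_free_pairing (V : vectType 'F_2) (J : finType) (f : J -> V)
    (ps : seq (J * J)) :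
    free_pairing f ps -> (2 * size ps + 3 <= #|J|)%N ->
  (forall i j, f i + f j \in <<gaps f ps>>%VS) \/
  exists2 ps', free_pairing f ps' & size ps' = (size ps).+1.
Proof.
move=> fps cJ; set U := <<_>>%VS.
have [r [r_inj r_out]] : exists r : 'I_3 -> J,
    injective r /\ forall i, r i \notin endpoints ps.
  by apply: three_outside; rewrite size_endpoints.
have [/existsP[i /existsP[j /and3P[iE jE ijU]]]|same] := boolP [exists i,
  exists j, [&& i \notin endpoints ps, j \notin endpoints ps & f i + f j \notin U]].
  right; exists ((i, j) :: ps) => //; rewrite /free_pairing /= free_cons ijU.
  case/andP: fps => -> ->; rewrite inE negb_or iE jE !andbT.
  by apply: contraNneq ijU => ->; rewrite F2_vect_addxx mem0v.
have {}same i j : i \notin endpoints ps -> j \notin endpoints ps -> f i + f j \in U.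
  move=> iE jE; apply: contraNT same => ijU.
  by apply/existsP; exists i; apply/existsP; exists j; rewrite iE jE.
pose r0 := r ord0.
have [/allP inU|/allPn[[a b] psq aU]] :=
  boolP (all (fun q => f q.1 + f r0 \in U) ps).
  left=> i j; suff toU k : f k + f r0 \in U.
    by have := rpredD (toU i) (toU j); rewrite (addrC (f j)) F2_vect_telescope.
  have [/endpointsP[q psq [] ->]|] := boolP (k \in endpoints ps).
  - exact: inU.
  - have qU : f q.1 + f q.2 \in U
      by apply: memv_span; apply: (map_f (fun q => f q.1 + f q.2)).
    have := rpredD qU (inU q psq).
    by rewrite (addrC (f q.1)) F2_vect_telescope.
  by move=> kE; apply: same; rewrite ?r_out.
right; set ps0 := rem (a, b) ps; set X := gaps f ps0; set u := f a + f b.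
have [eq_fps eq_E eq_U] := rem_free_pairing f psq.
rewrite -eq_fps in fps; rewrite -eq_U -/X in @U same aU *.
have memU v : (v \in U) = (v \in <<X>>%VS) || (v + u \in <<X>>%VS).
  exact: memv_span_cons.
case/andP: fps => /= uE; rewrite free_cons => /andP[uX fX].
have XU v : v \in <<X>>%VS -> v \in U by rewrite memU => ->.
have rU i : f (r i) + f r0 \in U by apply: same; apply: r_out.
have arU i : f a + f (r i) \notin U.
  apply: contra aU => aU; have := rpredD aU (rU i).
  by rewrite F2_vect_telescope.
(* The three free points lie in one coset of [U], which splits into two cosets of [<<X>>]; two of
   the points share one of these. *)
have [i [j [ij ijX]]] : exists i j, i != j /\ f (r i) + f (r j) \in <<X>>%VS.
  have := rU (inord 1); have := rU (inord 2); rewrite !memU.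
  case/orP=> r2; first by exists (inord 2), ord0; rewrite -val_eqE /= inordK.
  case/orP=> r1; first by exists (inord 1), ord0; rewrite -val_eqE /= inordK.
  exists (inord 1), (inord 2); split; first by rewrite -val_eqE /= !inordK.
  have := rpredD r1 r2; rewrite addrACA F2_vect_addxx addr0.
  by rewrite addrACA F2_vect_addxx addr0.
exists [:: (a, r i), (b, r j) & ps0]; last first.
  by rewrite /= size_rem //; case: (ps) psq.
have := r_out i; have := r_out j; rewrite -!eq_E /= !inE !negb_or.
case/and3P=> ja jb jE /and3P[ia ib iE].
have rij : r i != r j by rewrite (inj_eq r_inj).
rewrite /free_pairing /= !inE !negb_or !free_cons /= -/X fX andbT.
move: uE; rewrite /= inE negb_or => /and3P[/andP[ab aE] bE uE].
rewrite ab aE bE uE iE jE rij (eq_sym a) (eq_sym a (r j)) (eq_sym b).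
rewrite /= in ia ib ja jb; rewrite ia ib ja jb memv_span_cons negb_or /=.
(* A relation involving both new gaps would put [u] into [<<X>>]; one involving a single new gap
   would put [a] into the coset of the free points. *)
apply/andP; split.
  apply/andP; split; first by apply: contra (arU i); exact: XU.
  apply: contra uX => abX; have := rpredD abX ijX.
  by rewrite (addrACA (f a)) -(addrA (f a + f b)) F2_vect_addxx addr0.
apply: contra (arU j) => /XU bU; have uU : u \in U.
  by rewrite memU F2_vect_addxx mem0v orbT.
by have := rpredD uU bU; rewrite F2_vect_telescope.
Qed.

Lemma size_free_pairing (V : vectType 'F_2) (J : finType) (f : J -> V)
    (ps : seq (J * J)) :
  free_pairing f ps -> (size ps <= dim V)%N.
Proof.
case/andP=> _ /eqP; rewrite size_map => <-.
by rewrite -dimvf dimvS // subvf.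
Qed.

(** Extend the empty pairing until it spans: independence bounds the number of pairs by [dim V], so
    three terms are always left over. *)
Lemma spanning_free_pairing (V : vectType 'F_2) (J : finType) (f : J -> V) :
    (2 * dim V + 3 <= #|J|)%N ->
  exists2 ps, free_pairing f ps & forall i j, f i + f j \in <<gaps f ps>>%VS.
Proof.
move=> cJ; have grow n : (exists2 ps, free_pairing f ps
                 & forall i j, f i + f j \in <<gaps f ps>>%VS)
      \/ exists2 ps, free_pairing f ps & size ps = n.
  elim: n => [|n [IH|[ps fps szn]]]; [|by left|].
    by right; exists [::]; rewrite // /free_pairing nil_free.
  case: (extend_free_pairing fps).
  - by have := size_free_pairing fps; lia.
  - by left; exists ps.
  by case=> ps' fps' szps'; right; exists ps'; rewrite // szps' szn.
by case: (grow (dim V).+1) => // -[ps /size_free_pairing + szps]; rewrite szps ltnn.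
Qed.

(** Switching a pair from its first to its second term adds its gap; the gaps that sum to [v] tell
    which pairs to switch. *)
Lemma choose_endpoints (V : vectType 'F_2) (J : finType) (f : J -> V)
    (ps : seq (J * J)) (v : V) :
    uniq (endpoints ps) -> v \in <<gaps f ps>>%VS ->
  exists t : seq J, [/\ uniq t, {subset t <= endpoints ps}, size t = size ps
    & \sum_(j <- t) f j = v + \sum_(q <- ps) f q.1].
Proof.
elim: ps v => [|[a b] ps IH] v /=.
  by rewrite span_nil memv0 => _ /eqP->; exists [::]; rewrite !big_nil addr0.
rewrite inE negb_or memv_span_cons => /and3P[/andP[ab aE] bE uE] /orP[] vX.
  have [t [ut st szt sumt]] := IH _ uE vX; exists (a :: t); split.
  - by rewrite /= ut andbT; apply: contra aE; exact: st.
  - by move=> j; rewrite !inE => /orP[->|/st ->]; rewrite ?orbT.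
  - by rewrite /= szt.
  by rewrite !big_cons sumt addrCA.
have [t [ut st szt sumt]] := IH _ uE vX; exists (b :: t); split.
- by rewrite /= ut andbT; apply: contra bE; exact: st.
- by move=> j; rewrite !inE => /orP[->|/st ->]; rewrite ?orbT.
- by rewrite /= szt.
rewrite !big_cons sumt /= (addrA (f b)) (addrCA (f b) v).
by rewrite (addrCA (f b) (f a)) F2_vect_addxx addr0 -addrA.
Qed.

Lemma sum_even_mem (V : vectType 'F_2) (J : finType) (f : J -> V)
    (U : {vspace V}) (s : seq J) :
  (forall i j, f i + f j \in U) -> ~~ odd (size s) -> \sum_(j <- s) f j \in U.
Proof.
move=> fU; have [n] := ubnP (size s); elim: n s => // n IH [|a [|b s]] //=.
  by rewrite big_nil mem0v.
rewrite negbK !ltnS => szs ev; rewrite !big_cons addrA.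
by apply: rpredD => //; apply: IH => //; apply: ltnW.
Qed.

(** * Zero-sum index sets of size [2m] *)

Definition zero_sum_set (V : zmodType) (J : finType) (f : J -> V) (k : nat) :
    Prop :=
  exists2 A : {set J}, #|A| = k & \sum_(j in A) f j = 0.

Lemma zero_sum_set_seq (V : zmodType) (J : finType) (f : J -> V) (k : nat)
    (t : seq J) :
  uniq t -> size t = k -> \sum_(j <- t) f j = 0 -> zero_sum_set f k.
Proof.
move=> ut szt zt; exists [set j in t].
  by rewrite cardsE (card_uniqP ut).
by rewrite -[RHS]zt big_uniq //; apply: eq_bigl => j; rewrite inE.
Qed.

Lemma zero_sum_set_few_pairs (V : vectType 'F_2) (J : finType) (f : J -> V)
    (ps : seq (J * J)) (m : nat) :
    free_pairing f ps -> (forall i j, f i + f j \in <<gaps f ps>>%VS) ->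
    (size ps <= 2 * m)%N -> (4 * m <= #|J|)%N ->
  zero_sum_set f (2 * m).
Proof.
case/andP=> uE _ spanning le_ps cJ.
(* [W] fills the selection up to [2m] terms; [4m] indices suffice because there are at most [2m]
   pairs. *)
pose W := take (2 * m - size ps) (enum (~: [set j in endpoints ps])).
have szW : size W = (2 * m - size ps)%N.
  rewrite size_take_min; apply/minn_idPl; rewrite -cardE.
  have le_s : (#|[set j in endpoints ps]| <= size (endpoints ps))%N.
    by rewrite cardsE card_size.
  by move: cJ le_s; rewrite -(cardsC [set j in endpoints ps]) size_endpoints; lia.
(* This vector is the [v] of [choose_endpoints]: the first terms and [W] then occur twice each in
   the total sum and cancel. *)
have spanW : \sum_(q <- ps) f q.1 + \sum_(j <- W) f j \in <<gaps f ps>>%VS.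
  rewrite -(big_map (fun q => q.1) xpredT f) -big_cat; apply: sum_even_mem => //.
  by rewrite size_cat size_map szW subnKC // oddM.
have [t [ut st szt sumt]] := choose_endpoints uE spanW.
apply: (@zero_sum_set_seq _ _ f _ (t ++ W)).
- rewrite cat_uniq ut take_uniq ?enum_uniq // andbT.
  apply/hasPn => j /mem_take; rewrite mem_enum !inE; apply: contra; exact: st.
- by rewrite size_cat szt szW subnKC.
by rewrite big_cat /= sumt -[LHS]addrA F2_vect_addxx.
Qed.

Lemma zero_sum_set_full_pairing (V : vectType 'F_2) (J : finType) (f : J -> V)
    (ps : seq (J * J)) (m : nat) :
    free_pairing f ps -> (forall i j, f i + f j \in <<gaps f ps>>%VS) ->
    size ps = (2 * m + 1)%N -> (4 * m + 5 <= #|J|)%N ->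
  zero_sum_set f (2 * m).
Proof.
case/andP=> uE fX spanning szps cJ.
have [r [r_inj r_out]] : exists r : 'I_3 -> J,
    injective r /\ forall i, r i \notin endpoints ps.
  by apply: three_outside; rewrite size_endpoints szps; lia.
pose X := in_tuple (gaps f ps); pose K := 'I_(size (gaps f ps)).
have szK : size (gaps f ps) = (2 * m + 1)%N by rewrite size_map.
pose pair (k : K) := nth (r ord0, r ord0) ps k.
have ltk (k : K) : (k < size ps)%N by rewrite szps -szK.
pose g (x : (K * bool) + 'I_3) := match x with
  | inl (k, e) => if e then (pair k).2 else (pair k).1
  | inr q => r q
  end.
have gE k e : g (inl (k, e)) = nth (r ord0) (endpoints ps) (2 * k + e).
  by rewrite nth_endpoints.
have lte (k : K) (e : bool) : (2 * k + e < size (endpoints ps))%N.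
  by rewrite size_endpoints; have := ltk k; case: e; lia.
have g_inj : injective g.
  have gE_in k e : g (inl (k, e)) \in endpoints ps by rewrite gE mem_nth.
  move=> [[k e]|q] [[k' e']|q'] gg'.
  - move: gg'; rewrite !gE => /eqP; rewrite nth_uniq // => /eqP kk'.
    have ee' : e = e' by case: e e' kk' => -[] //; lia.
    by rewrite ee' in kk' *; congr (inl (_, _)); apply: val_inj => /=; lia.
  - by have := r_out q'; rewrite -[r q']gg' gE_in.
  - by have := r_out q; rewrite -[r q]/(g (inr q)) gg' gE_in.
  by rewrite (r_inj _ _ gg').
(* These linear forms are dual to the gaps. *)
pose phi (k : K) x := coord X k (f (g x)).
have diff k i : phi k (inl (i, true)) = phi k (inl (i, false)) + (k == i)%:R.
  have <- : coord X k X`_i = (k == i)%:R by rewrite coord_free // eq_sym.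
  rewrite (nth_map (r ord0, r ord0)) // linearD /= addrA F2_addxx add0r.
  by [].
have cK : #|K| = (2 * m + 1)%N by rewrite card_ord.
have odd_K : odd #|K| by rewrite cK oddD oddM.
have /existsP[A /andP[/eqP cA /forallP zA]] := coordinate_zero_sum_odd odd_K diff.
have szA : #|A| = (2 * m)%N by apply: succn_inj; rewrite cA cK addn1.
apply: (@zero_sum_set_seq _ _ f _ [seq g x | x <- enum A]).
- by rewrite map_inj_uniq ?enum_uniq.
- by rewrite size_map -cardE.
(* Vanishing coordinates imply a zero vector only within the span of the gaps, where every sum of
   evenly many terms lies. *)
set s := map _ _; have sX : \sum_(j <- s) f j \in <<X>>%VS.
  by apply: sum_even_mem => //; rewrite size_map -cardE szA oddM.
rewrite (coord_span sX) big1 // => k _.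
rewrite big_map big_enum /= linear_sum /=.
by rewrite (eqP (zA k)) scale0r.
Qed.

Lemma zero_sum_set_exists (V : vectType 'F_2) (J : finType) (f : J -> V)
    (m : nat) :
  dim V = (2 * m + 1)%N -> (4 * m + 5 <= #|J|)%N -> zero_sum_set f (2 * m).
Proof.
move=> dV cJ; have [|ps fps spanning] := @spanning_free_pairing V J f.
  by rewrite dV; lia.
have [le_ps|lt_ps] := leqP (size ps) (2 * m).
  by apply: (zero_sum_set_few_pairs fps spanning le_ps); lia.
apply: (zero_sum_set_full_pairing fps spanning) => //.
apply/eqP; rewrite eqn_leq addn1 lt_ps andbT -addn1 -dV.
exact: size_free_pairing fps.
Qed.

(** * From index sets to subsequences, and the upper bound *)

Lemma has_zero_sum_subseq_map (V : zmodType) (J : finType) (f : J -> V)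
    (k : nat) :
  has_zero_sum_subseq k [seq f j | j <- enum J] <-> zero_sum_set f k.
Proof.
split=> [[t [/subseqP[b szb tE] szt zt]]|[A cA zA]].
  rewrite -map_mask in tE; apply: (@zero_sum_set_seq _ _ _ _ (mask b (enum J))).
  - by rewrite mask_uniq ?enum_uniq.
  - by rewrite -szt tE size_map.
  by move: zt; rewrite tE big_map.
exists [seq f j | j <- enum A]; split.
- by apply: map_subseq; rewrite [enum J]enumT; apply: filter_subseq.
- by rewrite size_map -cardE.
by rewrite big_map big_enum.
Qed.

Lemma forces_zero_sum_upper (m : nat) :
  forces_zero_sum (Z2pow (2 * m + 1)) (2 * m) (4 * m + 5).
Proof.
move=> s szs.
have -> : s = [seq tnth (in_tuple s) i | i <- enum 'I_(size s)].
  by rewrite map_tnth_enum.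
apply/has_zero_sum_subseq_map.
apply: (@zero_sum_set_exists ('rV['F_2]_(2 * m + 1))).
  by rewrite dim_matrix; exact: mul1n.
by rewrite card_ord szs.
Qed.

(** * The extremal configuration and the lower bound *)

Lemma F2_natr_eq0 (n : nat) : n%:R = 0 :> 'F_2 -> ~~ odd n.
Proof.
rewrite -{1}(odd_double_half n) -addnn !natrD F2_addxx addr0.
by case: (odd n) => // /eqP; rewrite oner_eq0.
Qed.

(* In terms of the basis e_0, ..., e_(2m), the points (j, e) with j < 2m, j = 2m
   and j = 2m + 1 are e_j, 0 and e_0 + ... + e_(2m-1), to which e_(2m) is added
   when e holds. *)
Definition extremal_point (m : nat) (p : 'I_(2 * m).+2 * bool) :
    'rV['F_2]_(2 * m + 1) :=
  \row_k (if (k < 2 * m)%N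
          then (val p.1 == k) || (val p.1 == (2 * m).+1) else p.2)%:R.

(** Let [c j] count the chosen points of pair [j]. Each column [k < 2m] gives [c k] the parity of
    [c (2m+1)], and the last column makes the number of chosen points with [e = true] even. *)
Lemma extremal_point_zero_sum_free (m : nat) :
  odd m -> ~ zero_sum_set (@extremal_point m) (2 * m).
Proof.
move=> odd_m [A cA zA]; pose x (j : nat) e : nat := (inord j, e) \in A.
pose c j := (x j false + x j true)%N.
have sumA (F : nat -> bool -> nat) : (\sum_(p in A) F p.1 p.2 =
    \sum_(j < (2 * m).+2) (x j false * F j false + x j true * F j true))%N.
  transitivity (\sum_(j < (2 * m).+2) \sum_e
                  (if (j, e) \in A then F j e else 0))%N.
    by rewrite big_mkcond pair_bigA; apply: eq_bigr => -[].
  apply: eq_bigr => j _; rewrite big_bool /= addnC /x !inord_val.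
  by do 2 case: (_ \in A); rewrite ?mul1n ?mul0n.
have even_col (k : 'I_(2 * m + 1)) : ~~ odd (\sum_(j < (2 * m).+2)
    (x j false * (if k < 2 * m then (val j == k) || (val j == (2 * m).+1)
                  else false)
     + x j true * (if k < 2 * m then (val j == k) || (val j == (2 * m).+1)
                   else true)))%N.
  rewrite -(sumA (fun j e => if k < 2 * m then (j == k) || (j == (2 * m).+1)
                             else e)%N).
  apply: F2_natr_eq0; rewrite natr_sum.
  have zk : \sum_(p in A) extremal_point p ord0 k = 0 by rewrite -summxE zA mxE.
  rewrite -[RHS]zk.
  by apply: eq_bigr => p _; rewrite mxE.
have even_c k : (k < 2 * m)%N -> ~~ odd (c k + c (2 * m).+1).
  move=> ltk; have ltk' : (k < 2 * m + 1)%N by lia.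
  have := even_col (Ordinal ltk'); rewrite /= ltk.
  under eq_bigr do rewrite -mulnDl -/(c _).
  rewrite !big_ord_recr /= eqxx orbT muln1.
  have -> : (2 * m == k) = false by lia.
  have -> : (2 * m == (2 * m).+1) = false by lia.
  rewrite muln0 addn0 (bigD1 (Ordinal ltk)) //= eqxx muln1 big1 ?addn0 // => j jk.
  have := ltn_ord j; move: jk; rewrite -val_eqE /= => /negbTE -> ltj.
  by rewrite ltn_eqF ?muln0 // ltnS ltnW.
have even_x : ~~ odd (\sum_(j < (2 * m).+2) x j true).
  have ltk : (2 * m < 2 * m + 1)%N by lia.
  have := even_col (Ordinal ltk); rewrite /= ltnn.
  by under eq_bigr do rewrite muln0 muln1.
have sum_c : (\sum_(j < (2 * m).+2) c j = 2 * m)%N.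
  rewrite -[RHS]cA -sum1_card (sumA (fun _ _ => 1%N)).
  by apply: eq_bigr => j _; rewrite !muln1.
have x_le1 j e : (x j e <= 1)%N by rewrite /x; case: (_ \in _).
have sum_c' := sum_c; rewrite !big_ord_recr /= in sum_c'.
(* In the odd case the first [2m] pairs contribute one point each, leaving none for the pair
   [2m + 1]. *)
case odd_last: (odd (c (2 * m).+1)).
  have : (\sum_(j < 2 * m) c j = \sum_(j < 2 * m) 1)%N.
    apply: eq_bigr => j _; have := even_c j (ltn_ord j).
    rewrite oddD odd_last addbT negbK /c.
    by case: (x j false) (x_le1 j false) (x j true) (x_le1 j true)
      => [|[|?]] // _ [|[|?]].
  rewrite sum1_card card_ord => sum_1; rewrite sum_1 in sum_c'.
  by move: odd_last; have -> : c (2 * m).+1 = 0%N by lia.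
have even_c' j : (j < (2 * m).+2)%N -> ~~ odd (c j).
  have even_small k : (k < 2 * m)%N -> ~~ odd (c k).
    by move/even_c; rewrite oddD odd_last addbF.
  rewrite ltnS leq_eqVlt => /orP[/eqP->|]; first by rewrite odd_last.
  rewrite ltnS leq_eqVlt => /orP[/eqP->|]; last exact: even_small.
  (* No column constrains [c (2m)]; its parity follows from the total [2m]. *)
  have ev : ~~ odd (\sum_(k < 2 * m) c k).
    elim/big_ind: _ => // [a b /negbTE a0 /negbTE b0|k _].
      by rewrite oddD a0 b0.
    exact: even_small.
  by move: (c (2 * m)) (c (2 * m).+1) (\sum_(_ < _) _)%N sum_c' ev odd_last; lia.
(* Each pair is now taken in full or not at all, so exactly [m] chosen points have [e = true], an
   odd number. *)
have : (\sum_(j < (2 * m).+2) c j = 2 * \sum_(j < (2 * m).+2) x j true)%N.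
  rewrite big_distrr /=; apply: eq_bigr => j _; have := even_c' j (ltn_ord j).
  rewrite /c.
  by case: (x j false) (x_le1 j false) (x j true) (x_le1 j true)
    => [|[|?]] // _ [|[|?]].
by rewrite sum_c => sum_x; move: odd_m even_x; lia.
Qed.

Lemma forces_zero_sum_lower (m l : nat) : odd m ->
  forces_zero_sum (Z2pow (2 * m + 1)) (2 * m) l -> (4 * m + 5 <= l)%N.
Proof.
move=> odd_m forced; rewrite leqNgt; apply/negP => lt_l.
apply: (extremal_point_zero_sum_free odd_m).
apply/has_zero_sum_subseq_map; set s := map _ _.
(* There are [2 (2m + 2) = 4m + 4] extremal points, so a prefix of length [l] exists. *)
have [|t [ts szt zt]] := forced (take l s).
  by rewrite size_take_min size_map -cardE card_prod card_ord card_bool; lia.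
by exists t; split=> //; apply: subseq_trans ts (take_subseq _ _).
Qed.

Theorem theorem12 (m : nat) (hm : odd m) :
  zero_sum_constant_is (Z2pow (2 * m + 1)) (2 * m) (4 * m + 5).
Proof.
split; first exact: forces_zero_sum_upper.
by move=> l; exact: forces_zero_sum_lower.
Qed.
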